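(* Suppose that for every numerical semigroup $S\ne\mathbb{N}$ with $t(S)\ge e(S)$, writing $\mathrm{PF}(S)=\{f_1<\dots<f_{t}\}$ with $t=t(S)$ and $d=t(S)+1-e(S)$, one has $$\Theta(S)\;\ge\;\sum_{i=1}^{d}\lambda_S(f_i).$$ Then for every numerical semigroup $S\neq\mathbb{N}$ one has $e(S)\,n(S)\ge c(S)$ (Wilf's conjecture).
   Context: $\mathbb{N}=\{0,1,2,\dots\}$. A numerical semigroup is a submonoid $S\subseteq\mathbb{N}$ (under addition) with finite complement $G(S)=\mathbb{N}\setminus S$, whose elements are the gaps. Let $S\ne\mathbb{N}$. $F=\max G(S)$, $c(S)=F+1$, $n(S)=|S\cap[0,c(S))|$, and $e(S)$ is the cardinality of the unique minimal system of generators of $S$. An integer $f$ is a pseudo-Frobenius number if $f\notin S$ and $f+s\in S$ for all $s\in S\setminus\{0\}$; $\mathrm{PF}(S)$ is the set of these and $t(S)=|\mathrm{PF}(S)|$. For $y\in\mathbb{Z}$, $\lambda_S(y)=|S\cap[0,y]|$; for an integer $x\in[1,F]$, $\nu_S(x)=|\{f\in\mathrm{PF}(S): f-x\in S\}|$; and $\Theta(S)=\sum_{x\in G(S)}(\nu_S(x)-1)$. *)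

(* Defs.v *)
From mathcomp Require Import all_boot all_order all_algebra.
From mathcomp Require Import finmap.
From mathcomp Require Import boolp classical_sets functions cardinality.

Set Implicit Arguments.
Unset Strict Implicit.
Unset Printing Implicit Defensive.

Import Order.TTheory GRing.Theory Num.Theory.

Local Open Scope classical_set_scope.

(* [fset_set A] is empty when [A] is infinite; it is only used below on sets
   that are finite for every numerical semigroup S <> setT. *)
Definition set_card (T : choiceType) (A : set T) : nat := #|` fset_set A|.

Definition submonoid (M : set nat) : Prop :=
  M 0%N /\ (forall x y, M x -> M y -> M (x + y)%N).

Definition gaps (S : set nat) : set nat := ~` S.

Definition numerical_semigroup (S : set nat) : Prop :=
  submonoid S /\ finite_set (gaps S).

Definition frobenius (S : set nat) : nat := \max_(x <- fset_set (gaps S)) x.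

Definition conductor (S : set nat) : nat := (frobenius S).+1.

Definition left_count (S : set nat) : nat :=
  set_card [set x | S x /\ (x < conductor S)%N].

Definition generates (A S : set nat) : Prop := smallest submonoid A = S.

Definition minimal_generators (S A : set nat) : Prop :=
  generates A S /\ (forall B, B `<=` A -> generates B S -> B = A).

(* A numerical semigroup has exactly one minimal system of generators, so the
   default value [set0] plays no role. *)
Definition embdim (S : set nat) : nat :=
  set_card (xget set0 (minimal_generators S)).

Local Open Scope ring_scope.

Definition zset (S : set nat) : set int := [set n%:Z | n in S].

Definition PF (S : set nat) : set int :=
  [set f | ~ zset S f /\ (forall s, (zset S `\ 0) s -> zset S (f + s))].

Definition semigroup_type (S : set nat) : nat := set_card (PF S).

(* f_1 < ... < f_t of the mathematics is [PFnth S 0], ..., [PFnth S (t - 1)]. *)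
Definition PFnth (S : set nat) (i : nat) : int :=
  nth 0 (sort <=%R (fset_set (PF S))) i.

Definition lambda (S : set nat) (y : int) : nat :=
  set_card (zset S `&` [set z | 0 <= z <= y]).

Definition nu (S : set nat) (x : int) : nat :=
  set_card [set f | PF S f /\ zset S (f - x)].

Definition Theta (S : set nat) : int :=
  \sum_(x <- fset_set (gaps S)) ((nu S x%:Z)%:Z - 1).

(* Main.v *)
(* Counting the pairs (x, f) with x a gap, f in PF(S) and f - x in S in two ways
   gives Theta(S) = \sum_(f in PF(S)) lambda(f) - g, where g is the number of
   gaps: for fixed f the substitution x = f - s identifies the admissible x with
   S \cap [0, f].  Moreover lambda(f) <= n(S) for f in PF(S), and
   c(S) = g + n(S).  If t(S) < e(S), every gap lies below some f in PF(S) (in the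
   order given by S), so g <= t(S) n(S) <= (e(S) - 1) n(S).  If t(S) >= e(S), the
   assumed lower bound on Theta(S) cancels all but e(S) - 1 of the terms
   lambda(f), and again g <= (e(S) - 1) n(S). *)

Require Import Defs.
From mathcomp Require Import all_boot all_order all_algebra.
From mathcomp Require Import finmap zify.
From mathcomp Require Import boolp classical_sets functions cardinality.

Import Order.TTheory GRing.Theory Num.Theory.

Local Open Scope ring_scope.
Local Open Scope classical_set_scope.

(** * Cardinalities of finite sets *)

Lemma set_card_le (T : choiceType) (A B : set T) :
  finite_set B -> A `<=` B -> (set_card A <= set_card B)%N.
Proof.
move=> Bfin AB; apply: fsubset_leq_card.
by rewrite -fset_set_sub //; exact: sub_finite_set AB Bfin.
Qed.

Lemma set_card_image (T U : choiceType) (f : T -> U) (A : set T) :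
  injective f -> finite_set A -> set_card (f @` A) = set_card A.
Proof. by move=> f_inj Afin; rewrite /set_card fset_set_image // card_imfset. Qed.

Lemma set_cardU_le (T : choiceType) (A B : set T) :
  finite_set A -> finite_set B ->
  (set_card (A `|` B) <= set_card A + set_card B)%N.
Proof. by move=> Afin Bfin; rewrite /set_card fset_setU // cardfsU leq_subr. Qed.

(** The indicator form of a cardinality turns double counting into an exchange of sums. *)
Lemma set_card_sum (T : choiceType) (A : set T) (P : T -> Prop) :
  finite_set A ->
  set_card [set x | A x /\ P x] = (\sum_(x <- fset_set A) `[< P x >])%N.
Proof.
move=> Afin; rewrite -big_mkcond /= sum1_count -size_filter.
have APfin : finite_set [set x | A x /\ P x] by apply: sub_finite_set Afin => x [].
apply: perm_size; apply: uniq_perm; rewrite ?filter_uniq ?fset_uniq // => x.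
rewrite mem_filter !in_fset_set //.
apply/idP/andP => [|[/asboolP Px]]; rewrite !inE //.
by case=> Ax Px; split => //; apply/asboolP.
Qed.

Lemma Posz_sum (I : Type) (r : seq I) (F : I -> nat) :
  (\sum_(i <- r) F i)%N%:Z = \sum_(i <- r) (F i)%:Z.
Proof. by rewrite -natz natr_sum; apply: eq_bigr => i _; rewrite natz. Qed.

Section NumericalSemigroup.
Variables (S : set nat) (hS : numerical_semigroup S).

Let gaps_finite : finite_set (gaps S) := hS.2.

(** * Gaps, Frobenius and pseudo-Frobenius numbers *)

Lemma zsetE (n : nat) : zset S n%:Z <-> S n.
Proof. by split=> [[m Sm [<-]] //|Sn]; exists n. Qed.

Lemma zset_nat (z : int) : zset S z -> exists2 n : nat, S n & z = n%:Z.
Proof. by case=> n Sn <-; exists n. Qed.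

Lemma gap_le_frobenius (x : nat) : gaps S x -> (x <= frobenius S)%N.
Proof.
move=> xG; apply: (@leq_bigmax_seq _ _ _ id x) => //.
by rewrite in_fset_set // inE.
Qed.

Lemma frobenius_lt (x : nat) : (frobenius S < x)%N -> S x.
Proof. by move=> Fx; apply: contrapT => /gap_le_frobenius; rewrite leqNgt Fx. Qed.

Lemma conductor_le : (conductor S <= set_card (gaps S) + left_count S)%N.
Proof.
have Lfin : finite_set [set x | S x /\ (x < conductor S)%N].
  by apply: sub_finite_set (finite_II (conductor S)) => x [].
rewrite -(card_fset_set (card_eqxx `I_(conductor S))).
apply: leq_trans (set_cardU_le _ _ _ gaps_finite Lfin).
apply: set_card_le => [|x /= xc]; first by rewrite finite_setU.
by have [xG|/contrapT Sx] := pselect (gaps S x); [left | right].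
Qed.

Hypothesis hSN : S <> setT.

Lemma gaps_neq0 : (0 < set_card (gaps S))%N.
Proof.
rewrite lt0n cardfs_eq0; apply/eqP => /(fset_set_set0 gaps_finite) G0.
by apply: hSN; rewrite -[S]setCK -/(gaps S) G0 setC0.
Qed.

(** Since [S] is proper, the maximum runs over a nonempty family and is attained, so its value is
    not the default 0 of an empty maximum. *)
Lemma frobenius_gap : gaps S (frobenius S).
Proof.
have [x0 x0G] : exists x, gaps S x.
  by apply/set0P/eqP => G0; apply: hSN; rewrite -[S]setCK -/(gaps S) G0 setC0.
pose p x := `[< gaps S x >].
have pbound x : p x -> (x <= frobenius S)%N by move/asboolP/gap_le_frobenius.
have [|m /asboolP mG m_max] := @ex_maxnP p (frobenius S) _ pbound.
  by exists x0; apply/asboolP.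
suff <- : m = frobenius S by [].
apply/eqP; rewrite eqn_leq gap_le_frobenius //=; apply/bigmax_leqP_seq => x.
by rewrite in_fset_set // inE => xG _; apply: m_max; apply/asboolP.
Qed.

Lemma PF_gap (f : int) : PF S f -> exists2 n : nat, gaps S n & f = n%:Z.
Proof.
case=> fS fadd; case: (intP f) fS fadd => [|n|n] fS fadd.
- by exists 0%N => // /zsetE.
- by exists n.+1 => // /zsetE.
(* A negative [f = -(n + 1)] is impossible: the shift [frobenius S + n.+1] exceeds the Frobenius
   number, hence lies in [S], and adding it to [f] would put the Frobenius number in [S]. *)
- have /fadd : (zset S `\ 0) (frobenius S + n.+1)%:Z.
    split; first by apply/zsetE/frobenius_lt; lia.
    by move=> /= /eqP; rewrite eqz_nat; lia.
  have -> : - n.+1%:Z + (frobenius S + n.+1)%:Z = (frobenius S)%:Z by lia.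
  by move/zsetE => /frobenius_gap.
Qed.

Lemma PF_finite : finite_set (PF S).
Proof.
apply: sub_finite_set (finite_image Posz gaps_finite) => f /PF_gap[n nG ->].
by exists n.
Qed.

Lemma lambda_le (f : int) : PF S f -> (lambda S f <= left_count S)%N.
Proof.
move=> /PF_gap[n /gap_le_frobenius nF ->].
have Lfin : finite_set [set x | S x /\ (x < conductor S)%N].
  by apply: sub_finite_set (finite_II (conductor S)) => x [].
have Posz_inj : injective Posz by move=> ? ? [].
rewrite /left_count -(@set_card_image _ _ Posz) //.
apply: set_card_le; first exact: finite_image.
move=> _ [[m Sm <-] /= mn]; exists m => //=; split => //.
by rewrite ltnS; apply: leq_trans nF; rewrite -lez_nat.
Qed.

(** * Double counting of the pairs of a gap and a pseudo-Frobenius number *)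

Lemma lambda_gaps (f : int) : PF S f ->
  lambda S f = set_card [set x | gaps S x /\ zset S (f - x%:Z)].
Proof.
move=> PFf; have [n nG fE] := PF_gap f PFf.
have f_inj : injective (fun x : nat => f - x%:Z) by move=> x y; lia.
rewrite -(set_card_image _ _ _ _ f_inj); last by apply: sub_finite_set gaps_finite => x [].
congr set_card; apply/seteqP; split=> [_ [[m Sm <-] /= mf]|_ [x [xG zx] <-]].
  have mn : (m <= n)%N by lia.
  exists (n - m)%N; last by lia.
  split; last by exists m => //; lia.
  (* If [n - m] were in [S], then [n = (n - m) + m] would be too. *)
  by move=> Snm; apply: nG; rewrite -(subnK mn); exact: hS.1.2.
by split=> //=; case: zx => m _ mE; lia.
Qed.

Lemma sum_nu : (\sum_(x <- fset_set (gaps S)) nu S x%:Z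
  = \sum_(f <- fset_set (PF S)) lambda S f)%N.
Proof.
under eq_bigr => x _ do
  rewrite /nu (set_card_sum _ _ (fun f => zset S (f - x%:Z)) PF_finite).
rewrite exchange_big /=; apply: eq_big_seq => f.
by rewrite (in_fset_set PF_finite) inE => PFf; rewrite lambda_gaps // (set_card_sum _ _ _ gaps_finite).
Qed.

Lemma ThetaE : Theta S =
  (\sum_(f <- fset_set (PF S)) lambda S f)%:Z - (set_card (gaps S))%:Z.
Proof.
by rewrite -sum_nu /Theta sumrB /set_card card_fset_sum1 !Posz_sum.
Qed.

(** The gaps [y] with [y - x] in [S] include [x] itself and are bounded. The largest one, [m], is
    pseudo-Frobenius: if [m + k] were a gap for some nonzero [k] in [S], it would be a larger member
    of the family. *)
Lemma nu_gt0 (x : nat) : gaps S x -> (0 < nu S x%:Z)%N.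
Proof.
move=> xG.
pose p y := `[< gaps S y /\ zset S (y%:Z - x%:Z) >].
have pbound y : p y -> (y <= frobenius S)%N by move=> /asboolP[/gap_le_frobenius].
have [|m /asboolP[mG mx] m_max] := @ex_maxnP p (frobenius S) _ pbound.
  by exists x; apply/asboolP; split => //; rewrite subrr; exact/(zsetE 0)/hS.1.1.
have Nfin : finite_set [set f | PF S f /\ zset S (f - x%:Z)].
  by apply: sub_finite_set PF_finite => ? [].
rewrite lt0n cardfs_eq0; apply/eqP => /(fset_set_set0 Nfin) N0.
suff: [set f | PF S f /\ zset S (f - x%:Z)] m%:Z by rewrite N0.
split => //; split => [/zsetE //|s [/zset_nat[k Sk ->]] /= k0].
rewrite -PoszD; apply/zsetE; apply: contrapT => mkG.
have : p (m + k)%N.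
  apply/asboolP; split => //; have [l Sl mxl] := zset_nat _ mx.
  have -> : (m + k)%N%:Z - x%:Z = (l + k)%N%:Z by lia.
  by apply/zsetE/hS.1.2.
by move/m_max; have : k <> 0%N by [move=> k00; apply: k0; rewrite k00]; lia.
Qed.

(** By [nu_gt0] each gap contributes at least 1 to the left side of [sum_nu], while each term on its
    right side is at most [left_count S]. *)
Lemma card_gaps_le :
  (set_card (gaps S) <= semigroup_type S * left_count S)%N.
Proof.
apply: (@leq_trans (\sum_(f <- fset_set (PF S)) lambda S f)%N).
  rewrite -sum_nu /set_card card_fset_sum1 [X in (_ <= X)%N]big_seq big_seq.
  by apply: leq_sum => x; rewrite in_fset_set // inE => /nu_gt0.
rewrite /semigroup_type /set_card card_fset_sum1 big_distrl /= big_seq.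
rewrite [X in (_ <= X)%N]big_seq; apply: leq_sum => f; rewrite mul1n.
by rewrite in_fset_set ?inE; [exact: lambda_le|exact: PF_finite].
Qed.

(** * Splitting the sum along the increasing enumeration *)

Lemma sum_lambda_PFnth : (\sum_(f <- fset_set (PF S)) lambda S f
  = \sum_(0 <= i < semigroup_type S) lambda S (PFnth S i))%N.
Proof.
by rewrite -(perm_big _ (permEl (perm_sort <=%R _))) /= (big_nth 0) size_sort.
Qed.

Lemma PFnth_PF (i : nat) : (i < semigroup_type S)%N -> PF S (PFnth S i).
Proof.
move=> it; have : PFnth S i \in fset_set (PF S).
  by rewrite -(mem_sort <=%R) mem_nth // size_sort.
by rewrite in_fset_set ?inE //; exact: PF_finite.
Qed.

Lemma sum_lambda_tail_le (d : nat) :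
  (\sum_(d <= i < semigroup_type S) lambda S (PFnth S i)
    <= (semigroup_type S - d) * left_count S)%N.
Proof.
rewrite -sum_nat_const_nat big_nat [X in (_ <= X)%N]big_nat.
by apply: leq_sum => i /andP[_ it]; apply/lambda_le/PFnth_PF.
Qed.

Lemma sum_lambda_le (d : nat) : (\sum_(f <- fset_set (PF S)) lambda S f
  <= \sum_(i < d) lambda S (PFnth S i)
     + (semigroup_type S - d) * left_count S)%N.
Proof.
rewrite sum_lambda_PFnth -(big_mkord xpredT (fun i => lambda S (PFnth S i))).
have [dt|/ltnW td] := leqP d (semigroup_type S).
  by rewrite (@big_cat_nat _ _ _ d) //= leq_add2l sum_lambda_tail_le.
(* Here [d] reaches or passes the type: the truncated difference is 0, and any terms beyond the full
   sum, taken at the default value of [nth], only enlarge the bound. *)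
by rewrite (@big_cat_nat _ _ _ (semigroup_type S) 0%N d) //= -addnA leq_addr.
Qed.

End NumericalSemigroup.

Theorem proposition5p3
  (H : forall S : set nat,
     numerical_semigroup S -> S <> setT ->
     (embdim S <= semigroup_type S)%N ->
     \sum_(i < semigroup_type S + 1 - embdim S) (lambda S (PFnth S i))%:Z
       <= Theta S)
  (S : set nat) (hS : numerical_semigroup S) (hSN : S <> setT) :
  (conductor S <= embdim S * left_count S)%N.
Proof.
have c_le := conductor_le S hS.
have g_gt0 := gaps_neq0 S hS hSN.
suff : (set_card (gaps S) <= (embdim S).-1 * left_count S)%N.
  (* If [embdim S] were 0, the bound would leave no gaps, against [g_gt0]; otherwise one more
     [left_count S] is added to reach the conductor. *)
  by case: (embdim S) => [|e] /=; rewrite ?mulSn; lia.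
have [et|te] := leqP (embdim S) (semigroup_type S); last first.
  by apply: leq_trans (card_gaps_le S hS hSN) _; rewrite leq_mul2r; lia.
have := H S hS hSN et; rewrite ThetaE //.
rewrite -Posz_sum.
have := sum_lambda_le S hS hSN (semigroup_type S + 1 - embdim S).
(* For [embdim S = 0] both sides are 0 by truncation. *)
have -> : (semigroup_type S - (semigroup_type S + 1 - embdim S) = (embdim S).-1)%N.
  by lia.
(* With [b] the full sum and [c] its assumed lower bound part, the number of gaps is at most
   [b - c], which is at most [(embdim S).-1 * left_count S]. *)
set b := (\sum_(f <- _) _)%N; set c := bigop _ _ _; lia.
Qed.
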